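(* Let $(M,\mathbf g)$ be a finite-dimensional (pseudo-)Riemannian manifold endowed with a Poisson bracket $\{\cdot,\cdot\}$, let $G\in C^\infty(M)$, and let $\mathbf v_G$ be the generalized double bracket vector field of $G$. Then $\mathbf v_G$ is tangent to every regular symplectic leaf of $M$. Moreover, for every regular symplectic leaf $\Sigma\subset M$ on which the induced (pseudo-)metric $\mathbf g^{\Sigma}_{ind}$ is non-degenerate (automatic when $\mathbf g$ is Riemannian), so that the double bracket metric $\boldsymbol\tau^{\Sigma}_{db}$ is defined, the restriction of $\mathbf v_G$ to $\Sigma$ is $$(\mathbf v_G)_{|\Sigma}=-\nabla_{\boldsymbol\tau^{\Sigma}_{db}}\,G_{|\Sigma},$$ where $\nabla_{\boldsymbol\tau^{\Sigma}_{db}}$ denotes the gradient on $\Sigma$ with respect to the (pseudo-)Riemannian metric $\boldsymbol\tau^{\Sigma}_{db}$.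
   Context: Let $\boldsymbol\Pi$ be the skew-symmetric contravariant 2-tensor associated with the bracket, $\boldsymbol\Pi(dF,dH)=\{F,H\}$, and let $\#_{\boldsymbol\Pi}:\Omega^1(M)\to\mathcal X(M)$ be the induced map, $\beta(\#_{\boldsymbol\Pi}\alpha)=\boldsymbol\Pi(\beta,\alpha)$; thus $\#_{\boldsymbol\Pi}dH=X_H$ is the Hamiltonian vector field of $H$, with $dF(X_H)=\{F,H\}$. The co-metric double bracket tensor is the symmetric contravariant 2-tensor $\mathbf D(\alpha,\beta):=\mathbf g(\#_{\boldsymbol\Pi}\alpha,\#_{\boldsymbol\Pi}\beta)$ for $\alpha,\beta\in\Omega^1(M)$. For $G\in C^\infty(M)$ the generalized double bracket vector field is $\mathbf v_G:=-\mathbf i_{dG}\mathbf D$, i.e. $\alpha(\mathbf v_G)=-\mathbf D(dG,\alpha)$ for all $\alpha\in\Omega^1(M)$. A symplectic leaf $\Sigma$ is regular if the rank of $\boldsymbol\Pi$ is constant in a neighbourhood of each point of $\Sigma$ (equivalently, the transverse Poisson structure in Darboux–Weinstein coordinates around points of $\Sigma$ vanishes identically). Double bracket metric: let $\omega\in\Omega^2(\Sigma)$ be the symplectic form induced on the leaf $\Sigma$ (so $\omega(X_F,X_H)=\{F,H\}$ along $\Sigma$, up to an overall sign convention which does not affect what follows), let $\mathbf g^{\Sigma}_{ind}$ be the symmetric 2-tensor induced on $\Sigma$ by $\mathbf g$, and, when it is non-degenerate, let $(\mathbf g^{\Sigma}_{ind})^{-1}$ be the associated co-metric tensor on $T^*\Sigma$.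 Then for $x\in\Sigma$ and $X,Y\in\mathcal X(\Sigma)$, $$\boldsymbol\tau^{\Sigma}_{db}(x)(X(x),Y(x)):=(\mathbf g^{\Sigma}_{ind})^{-1}(x)\big(\mathbf i_X\omega(x),\mathbf i_Y\omega(x)\big).$$ The gradient of $f\in C^\infty(\Sigma)$ is defined by $\boldsymbol\tau^{\Sigma}_{db}(\nabla_{\boldsymbol\tau^{\Sigma}_{db}}f,Y)=df(Y)$ for all $Y\in\mathcal X(\Sigma)$. *)

(* Defs.v *)
From HB Require Import structures.
From mathcomp Require Import all_boot all_order all_algebra.
From mathcomp Require Import all_classical all_reals all_analysis.
Set Implicit Arguments.
Unset Strict Implicit.
Unset Printing Implicit Defensive.
Import Order.TTheory GRing.Theory Num.Theory.
Import numFieldNormedType.Exports.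
Local Open Scope classical_set_scope.
Local Open Scope ring_scope.

(** Conventions. A tangent vector at a point [x] of a manifold is the row vector
    of its coordinates in a preferred chart [chart_at x] around [x], and a
    covector at [x] is the column vector of its coordinates in the dual basis;
    the pairing of a covector [a] with a tangent vector [v] is the scalar
    [v *m a]. Field regularity is always tested in the charts of the atlas. *)

Section EuclideanSmoothness.
Context {R : realType} {n : nat}.

Fixpoint Ck (k : nat) (U : set 'rV[R]_n) (f : 'rV[R]_n -> R) : Prop :=
  match k with
  | 0%N => forall x, U x -> {for x, continuous f}
  | k'.+1 => (forall x, U x -> differentiable f x) /\
             (forall v : 'rV[R]_n, Ck k' U (fun x => 'd f x v))
  end.

Definition smooth_on (U : set 'rV[R]_n) (f : 'rV[R]_n -> R) : Prop :=
  forall k, Ck k U f.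

Definition smooth_mx_on {p q : nat} (U : set 'rV[R]_n)
    (A : 'rV[R]_n -> 'M[R]_(p, q)) : Prop :=
  forall i j, smooth_on U (fun x => A x i j).

End EuclideanSmoothness.

(** A homeomorphism from the open set [dom] onto the open set [cod]; the maps
    [fwd] and [bwd] are total, their values outside [dom] and [cod] are junk. *)
Record chart (R : realType) (n : nat) (T : topologicalType) := Chart {
  dom : set T;
  cod : set 'rV[R]_n;
  fwd : T -> 'rV[R]_n;
  bwd : 'rV[R]_n -> T;
  dom_open : open dom;
  cod_open : open cod;
  fwd_cod : forall x, dom x -> cod (fwd x);
  bwd_dom : forall y, cod y -> dom (bwd y);
  fwdK : forall x, dom x -> bwd (fwd x) = x;
  bwdK : forall y, cod y -> fwd (bwd y) = y;
  fwd_continuous : forall x, dom x -> {for x, continuous fwd};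
  bwd_continuous : forall y, cod y -> {for y, continuous bwd} }.

Record manifold (R : realType) (n : nat) := Manifold {
  carrier :> topologicalType;
  manifold_hausdorff : hausdorff_space carrier;
  manifold_second_countable : @second_countable carrier;
  atlas : set (chart R n carrier);
  chart_at : carrier -> chart R n carrier;
  chart_at_atlas : forall x, atlas (chart_at x);
  chart_at_dom : forall x, dom (chart_at x) x;
  atlas_compatible : forall c d, atlas c -> atlas d ->
    smooth_mx_on (cod c `&` bwd c @^-1` dom d) (fwd d \o bwd c) }.
Arguments atlas {R n} _.
Arguments chart_at {R n} {_} _.

Section Manifolds.
Context {R : realType} {n : nat}.
Implicit Type M : manifold R n.

Definition smooth_fun M (F : M -> R) : Prop :=
  forall c, atlas M c -> smooth_on (cod c) (F \o bwd c).

(** [dF_x], as a covector. *)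
Definition dfun M (F : M -> R) (x : M) : 'cV[R]_n :=
  let c := chart_at x in
  \col_j 'd (F \o bwd c) (fwd c x) (delta_mx 0 j).

Definition smooth_map M {k : nat} (S : manifold R k) (f : S -> M) : Prop :=
  continuous f /\
  forall c d, atlas S c -> atlas M d ->
    smooth_mx_on (cod c `&` (f \o bwd c) @^-1` dom d) (fwd d \o f \o bwd c).

(** The tangent map [T_s f : T_s S -> T_(f s) M] is [u |-> u *m dmap f s]. *)
Definition dmap M {k : nat} (S : manifold R k) (f : S -> M) (s : S)
    : 'M[R]_(k, n) :=
  'J (fwd (chart_at (f s)) \o f \o bwd (chart_at s)) (fwd (chart_at s) s).

(** 2-tensor fields, covariant or contravariant, are fields of matrices. *)
Definition cov M (g : M -> 'M[R]_n) (x : M) (u v : 'rV[R]_n) : R :=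
  (u *m g x *m v^T) 0 0.

Definition contra M (P : M -> 'M[R]_n) (x : M) (a b : 'cV[R]_n) : R :=
  (a^T *m P x *m b) 0 0.

(** Rows: the coordinate vectors of the chart [c] at [x], expressed, as every
    tangent vector at [x], in the preferred chart. *)
Definition frame M (c : chart R n M) (x : M) : 'M[R]_n :=
  'J (fwd (chart_at x) \o bwd c) (fwd c x).

(** Columns: the differentials at [x] of the coordinates of the chart [c]. *)
Definition coframe M (c : chart R n M) (x : M) : 'M[R]_n :=
  'J (fwd c \o bwd (chart_at x)) (fwd (chart_at x) x).

Definition smooth_cov M (g : M -> 'M[R]_n) : Prop :=
  forall c, atlas M c -> smooth_mx_on (cod c)
    (fun y => let x := bwd c y in frame c x *m g x *m (frame c x)^T).

Definition smooth_contra M (P : M -> 'M[R]_n) : Prop :=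
  forall c, atlas M c -> smooth_mx_on (cod c)
    (fun y => let x := bwd c y in (coframe c x)^T *m P x *m coframe c x).

Definition nondegenerate_form (b : 'rV[R]_n -> 'rV[R]_n -> R) : Prop :=
  forall u, (forall v, b u v = 0) -> u = 0.

Definition pseudo_riemannian M (g : M -> 'M[R]_n) : Prop :=
  [/\ smooth_cov g,
      forall x u v, cov g x u v = cov g x v u
    & forall x, nondegenerate_form (cov g x)].

Definition riemannian M (g : M -> 'M[R]_n) : Prop :=
  pseudo_riemannian g /\ forall x u, u != 0 -> 0 < cov g x u u.

(** A bracket on C^oo(M); its values on non-smooth functions are junk. *)
Record poisson_bracket M (br : (M -> R) -> (M -> R) -> (M -> R)) : Prop := {
  br_smooth : forall F H, smooth_fun F -> smooth_fun H -> smooth_fun (br F H);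
  br_linear : forall (a : R) F K H,
    smooth_fun F -> smooth_fun K -> smooth_fun H ->
    forall x, br (fun y => a * F y + K y) H x = a * br F H x + br K H x;
  br_skew : forall F H, smooth_fun F -> smooth_fun H ->
    forall x, br F H x = - br H F x;
  br_leibniz : forall F K H, smooth_fun F -> smooth_fun K -> smooth_fun H ->
    forall x, br (fun y => F y * K y) H x = F x * br K H x + br F H x * K x;
  br_jacobi : forall F K H, smooth_fun F -> smooth_fun K -> smooth_fun H ->
    forall x, br F (br K H) x + br K (br H F) x + br H (br F K) x = 0 }.

Definition poisson_tensor M (br : (M -> R) -> (M -> R) -> (M -> R))
    (P : M -> 'M[R]_n) : Prop :=
  [/\ smooth_contra P,
      forall x a b, contra P x a b = - contra P x b a
    & forall F H, smooth_fun F -> smooth_fun H ->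
        forall x, contra P x (dfun F x) (dfun H x) = br F H x].

Definition sharp M (P : M -> 'M[R]_n) (x : M) (a : 'cV[R]_n) : 'rV[R]_n :=
  (P x *m a)^T.

Lemma sharpE M (P : M -> 'M[R]_n) (x : M) (a b : 'cV[R]_n) :
  (sharp P x a *m b) 0 0 = contra P x b a.
Proof.
by rewrite /sharp /contra -mulmxA -[b in LHS]trmxK -trmx_mul mxE.
Qed.

Definition hamiltonian_vf M (P : M -> 'M[R]_n) (H : M -> R) (x : M)
    : 'rV[R]_n :=
  sharp P x (dfun H x).

Definition double_bracket_tensor M (g P : M -> 'M[R]_n) (x : M)
    (a b : 'cV[R]_n) : R :=
  cov g x (sharp P x a) (sharp P x b).

Definition double_bracket_vf M (g P : M -> 'M[R]_n) (G : M -> R) (x : M)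
    : 'rV[R]_n :=
  - \row_j double_bracket_tensor g P x (dfun G x) (delta_mx j 0).

Lemma double_bracket_vfE M (g P : M -> 'M[R]_n) (G : M -> R) (x : M)
    (a : 'cV[R]_n) :
  (double_bracket_vf g P G x *m a) 0 0 =
  - double_bracket_tensor g P x (dfun G x) a.
Proof.
rewrite /double_bracket_vf mulNmx mxE; congr (- _).
rewrite /double_bracket_tensor /cov /sharp trmxK mulmxA.
set L := (X in _ = (X *m a) 0 0); congr ((_ *m a) 0 0).
by apply/matrixP => i j; rewrite ord1 mxE trmxK mulmxA -/L -colE mxE.
Qed.

(** Symplectic leaves are the maximal connected integral manifolds of the
    characteristic distribution [x |-> im (sharp P x)]. A leaf is an immersed
    submanifold, in general not embedded: it comes with its own manifold
    structure [S] and an injective immersion [i], its inclusion in [M]. *)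
Definition integral_manifold M (P : M -> 'M[R]_n) {k : nat} (S : manifold R k)
    (i : S -> M) : Prop :=
  [/\ [set: S] !=set0 /\ connected [set: S],
      smooth_map i /\ injective i,
      forall s, row_free (dmap i s)
    & forall s (v : 'rV[R]_n),
        (exists u, v = u *m dmap i s) <-> (exists a, v = sharp P (i s) a)].

Definition symplectic_leaf M (P : M -> 'M[R]_n) {k : nat} (S : manifold R k)
    (i : S -> M) : Prop :=
  integral_manifold P i /\
  forall (k' : nat) (S' : manifold R k') (i' : S' -> M),
    integral_manifold P i' ->
    range i `&` range i' !=set0 -> range i' `<=` range i.

Definition regular_leaf M (P : M -> 'M[R]_n) {k : nat} (S : manifold R k)
    (i : S -> M) : Prop :=
  symplectic_leaf P i /\
  forall s, \forall y \near i s, \rank (P y) = \rank (P (i s)).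

Definition tangent_along M {k : nat} (S : manifold R k) (i : S -> M)
    (V : M -> 'rV[R]_n) : Prop :=
  forall s, exists u : 'rV[R]_k, V (i s) = u *m dmap i s.

Definition restricts_to M {k : nat} (S : manifold R k) (i : S -> M)
    (V : M -> 'rV[R]_n) (W : S -> 'rV[R]_k) : Prop :=
  forall s, V (i s) = W s *m dmap i s.

(** The vectors [u] and [v] below are [X_F] and [X_H], seen as tangent vectors
    of the leaf. *)
Definition leaf_symplectic_form M (br : (M -> R) -> (M -> R) -> (M -> R))
    (P : M -> 'M[R]_n) {k : nat} (S : manifold R k) (i : S -> M)
    (w : S -> 'M[R]_k) : Prop :=
  forall F H, smooth_fun F -> smooth_fun H ->
  forall s (u v : 'rV[R]_k),
    u *m dmap i s = hamiltonian_vf P F (i s) ->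
    v *m dmap i s = hamiltonian_vf P H (i s) ->
    (u *m w s *m v^T) 0 0 = br F H (i s).

Definition induced_metric M (g : M -> 'M[R]_n) {k : nat} (S : manifold R k)
    (i : S -> M) (s : S) : 'M[R]_k :=
  dmap i s *m g (i s) *m (dmap i s)^T.

End Manifolds.

Section DoubleBracketMetric.
Context {R : realType} {k : nat} {S : manifold R k}.

Definition two_form (w : S -> 'M[R]_k) : Prop :=
  smooth_cov w /\ forall s u v, cov w s u v = - cov w s v u.

(** The covector [v |-> w(u, v)]. *)
Definition interior (w : S -> 'M[R]_k) (s : S) (u : 'rV[R]_k) : 'cV[R]_k :=
  (u *m w s)^T.

(** The matrix of the co-metric associated with a non-degenerate metric is the
    inverse of the matrix of the metric. *)
Definition cometric (g : S -> 'M[R]_k) (s : S) (a b : 'cV[R]_k) : R :=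
  contra (fun s => invmx (g s)) s a b.

(** For [h] the metric induced on the leaf and [w] its symplectic form. *)
Definition double_bracket_metric (h w : S -> 'M[R]_k) (s : S)
    (u v : 'rV[R]_k) : R :=
  cometric h s (interior w s u) (interior w s v).

Definition is_gradient (tau : S -> 'rV[R]_k -> 'rV[R]_k -> R) (f : S -> R)
    (W : S -> 'rV[R]_k) : Prop :=
  forall s (v : 'rV[R]_k), tau s (W s) v = (v *m dfun f s) 0 0.

End DoubleBracketMetric.

(* Main.v *)
Require Import Defs.
From HB Require Import structures.
From mathcomp Require Import all_boot all_order all_algebra.
From mathcomp Require Import all_classical all_reals all_analysis.
From mathcomp Require Import ring.
Import Order.TTheory GRing.Theory Num.Theory.
Import numFieldNormedType.Exports.
Set Implicit Arguments.
Unset Strict Implicit.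
Unset Printing Implicit Defensive.
Local Open Scope classical_set_scope.
Local Open Scope ring_scope.

(** The statement is pointwise linear algebra, once it is known that every
    covector at a point of [M] is the differential of a global smooth function.

    Fix a point of a leaf. Let [J] be the matrix of the inclusion of the tangent
    space of the leaf, [P], [g] and [w] the matrices of the Poisson tensor, the
    metric and the symplectic form, and [a] the covector [dG]. In row-vector
    conventions the double bracket vector is [a^T P g P]. It lies in the row
    space of [P], which is the tangent space of the leaf because [P] is skew:
    this is tangency. If [g] is definite, so is its restriction to a subspace.

    For the gradient formula, write [P = B J]. The defining property of the
    symplectic form amounts to [P = B w B^T], hence to [J = w B^T]
    ([leaf_form_factorization]); in particular [w] is invertible, and so is
    [tau = w h^-1 w^T], where [h = J g J^T]. The gradient [W] of the restriction
    of [G] solves [W tau = (J a)^T], by the chain rule [dfun_comp], and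
    eliminating [B] and [w] gives [W J = - a^T P g P]
    ([double_bracket_gradient]).

    The symplectic form is specified only by its values on Hamiltonian vector
    fields of functions defined on all of [M], so these have to span the tangent
    space of the leaf. This is the analytic part ([exists_smooth_dfun]): a linear
    form in a chart is cut off by a bump function built from [exp (- 1 / t)] and
    extended by zero. It rests on the stability of smoothness, defined by
    iterated differentials, under products and composition ([CkM], [Ck_comp]),
    and on the smoothness of [exp (- 1 / t)] extended by zero ([Ck_flat]). *)

(** * Smoothness in Euclidean space *)

(** The differential depends only on the germ of the function: the first-order
    expansion is a statement about points close to the base point. *)
Lemma near_eq_is_diff {R : numFieldType} {V W : normedModType R}
    (f g : V -> W) (x : V) :
  (\forall y \near x, f y = g y) -> differentiable f x ->
  differentiable g x /\ 'd g x = 'd f x :> (V -> W).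
Proof.
move=> fg df.
have og : g \o shift x = cst (g x) + 'd f x +o_ 0 id.
  apply/eqaddoP => e e0; have /eqaddoP/(_ e e0) := diff_locally df.
  move: (fg); rewrite (near_shift 0) subr0; apply: filterS2 => h /= fgh.
  by rewrite !fctE /= fgh (nbhs_singleton fg).
have dgE : 'd g x = 'd f x :> (V -> W).
  by apply: diff_unique => //; exact: diff_continuous.
split=> //; apply/diff_locallyP; rewrite dgE; split=> //.
exact: diff_continuous.
Qed.

Section CkTheory.
Context {R : realType}.

(** [Ck] constrains its function point by point on [U]; this is what lets
    smoothness be checked on an open cover. *)
Lemma Ck_local {n} k (U : set 'rV[R]_n) f :
  (forall x, U x -> exists2 V, V x & Ck k V f) -> Ck k U f.
Proof.
elim: k f => [|k IH] f loc /=.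
  by move=> x /loc[V Vx]; apply.
split=> [x /loc[V Vx []]|v]; first by move=> + _; apply.
by apply: IH => x /loc[V Vx [_ dV]]; exists V; last exact: dV.
Qed.

Lemma Ck_sub {n} k (U V : set 'rV[R]_n) f : U `<=` V -> Ck k V f -> Ck k U f.
Proof. by move=> UV Vf; apply: Ck_local => x /UV Vx; exists V. Qed.

Lemma CkW {n} k (U : set 'rV[R]_n) f : Ck k.+1 U f -> Ck k U f.
Proof.
elim: k f => [|k IH] f [df ddf].
  by move=> x Ux; exact/differentiable_continuous/df.
by split=> // v; exact/IH/ddf.
Qed.

(** Openness of [U] makes both functions have the same germ at every point of
    [U], so the equality passes to all iterated derivatives. *)
Lemma Ck_eq {n} k (U : set 'rV[R]_n) f g :
  open U -> (forall x, U x -> f x = g x) -> Ck k U f -> Ck k U g.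
Proof.
move=> Uo fg; have fgn x : U x -> \forall y \near x, f y = g y.
  by move=> Ux; apply: filterS fg _; exact: open_nbhs_nbhs.
elim: k f g fg fgn => [|k IH] f g fg fgn.
  move=> cf x Ux; change (g @ x --> g x); rewrite -(fg _ Ux).
  by apply: cvg_trans (cf x Ux); apply: (@near_eq_cvg _ _ (nbhs x)); exact: fgn.
move=> [df ddf]; split=> [x Ux|v].
  by have [] := near_eq_is_diff (fgn x Ux) (df x Ux).
have dfg x : U x -> 'd f x v = 'd g x v.
  by move=> Ux; have [_ ->] := near_eq_is_diff (fgn x Ux) (df x Ux).
apply: IH (ddf v) => // x Ux; apply: filterS dfg _; exact: open_nbhs_nbhs.
Qed.

Lemma Ck_cst {n} k (U : set 'rV[R]_n) (a : R) : Ck k U (cst a).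
Proof.
elim: k a => [|k IH] a /=; first by move=> x _; exact: cst_continuous.
split=> [x _|v]; first exact: differentiable_cst.
by under eq_fun do rewrite diff_cst; exact: IH.
Qed.

Lemma CkD {n} k (U : set 'rV[R]_n) f g :
  open U -> Ck k U f -> Ck k U g -> Ck k U (fun x => f x + g x).
Proof.
move=> Uo; elim: k f g => [|k IH] f g.
  by move=> cf cg x Ux; apply: continuousD; [exact: cf|exact: cg].
move=> [df ddf] [dg ddg]; split=> [x Ux|v].
  by apply: differentiableD; [exact: df|exact: dg].
apply: (Ck_eq Uo _ (IH _ _ (ddf v) (ddg v))) => x Ux.
by rewrite (diffD (df x Ux) (dg x Ux)).
Qed.

(** By the Leibniz rule a derivative of the product is again a sum of products,
    whose factors have one order of differentiability less: hence the induction,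
    with [CkW] for the factors that are not differentiated. *)
Lemma CkM {n} k (U : set 'rV[R]_n) f g :
  open U -> Ck k U f -> Ck k U g -> Ck k U (fun x => f x * g x).
Proof.
move=> Uo; elim: k f g => [|k IH] f g.
  by move=> cf cg x Ux; apply: continuousM; [exact: cf|exact: cg].
move=> sf sg; have [df ddf] := sf; have [dg ddg] := sg; split=> [x Ux|v].
  by apply: differentiableM; [exact: df|exact: dg].
apply: (Ck_eq Uo _ (CkD Uo (IH _ _ (CkW sf) (ddg v)) (IH _ _ (CkW sg) (ddf v)))).
by move=> x Ux; rewrite (diffM (df x Ux) (dg x Ux)).
Qed.

Lemma Ck_sum {n} k (U : set 'rV[R]_n) (I : Type) (r : seq I)
    (f : I -> 'rV[R]_n -> R) :
  open U -> (forall i, Ck k U (f i)) -> Ck k U (fun x => \sum_(i <- r) f i x).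
Proof.
move=> Uo sf; elim: r => [|i r IH].
  by under eq_fun do rewrite big_nil; exact: Ck_cst.
by under eq_fun do rewrite big_cons; exact: CkD.
Qed.

Lemma differentiable_mx_coords {V : normedModType R} {m n} (f : V -> 'M[R]_(m, n)) x :
  (forall i j, differentiable (fun y => f y i j) x) ->
  differentiable f x /\
  forall v i j, ('d f x v) i j = 'd (fun y => f y i j) x v.
Proof.
move=> df.
have fE : f = \sum_i \sum_j (fun y => f y i j *: delta_mx i j).
  apply/funext => y; rewrite [LHS]matrix_sum_delta fct_sumE.
  by apply: eq_bigr => i _; rewrite fct_sumE.
have dfx : differentiable f x.
  rewrite fE; apply: differentiable_sum => i; apply: differentiable_sum => j.
  exact: differentiableZl.
split=> // v i j.
pose c (N : 'M[R]_(m, n)) : R := N i j.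
have cl : linear c by move=> a u w; rewrite /c !mxE.
pose clM := GRing.isLinear.Build _ _ _ _ _ cl.
pose cL : {linear _ -> _} := HB.pack c clM.
have cc : continuous cL by exact: coord_continuous.
rewrite (_ : (fun y => f y i j) = cL \o f) //.
rewrite (diff_comp dfx (linear_differentiable _ cc)) /=.
by rewrite (diff_lin _ cc).
Qed.

Lemma smooth_mx_diff {n p q} (U : set 'rV[R]_n) (h : 'rV[R]_n -> 'M[R]_(p, q)) x :
  smooth_mx_on U h -> U x ->
  differentiable h x /\
  forall v i j, ('d h x v) i j = 'd (fun y => h y i j) x v.
Proof.
move=> sh Ux; apply: differentiable_mx_coords => i j.
by have [+ _] := sh i j 1%N; apply.
Qed.

(** Derivatives in a direction that varies with the point are combinations of
    partial derivatives, the form in which the chain rule can be iterated. *)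
Lemma diff_rVE {n} (f : 'rV[R]_n -> R) (y v : 'rV[R]_n) :
  'd f y v = \sum_j v 0 j * 'd f y (delta_mx 0 j).
Proof.
by rewrite {1}[v]row_sum_delta linear_sum; apply: eq_bigr => j _; rewrite linearZ.
Qed.

(** Faa di Bruno without the combinatorics: the chain rule writes a derivative
    of [f \o h] as a sum of products of derivatives of the coordinates of [h]
    with partial derivatives of [f] composed with [h], and the induction
    hypothesis applies to the latter. *)
Lemma Ck_comp {m n} k (U : set 'rV[R]_m) (V : set 'rV[R]_n)
    (h : 'rV[R]_m -> 'rV[R]_n) f :
  open U -> (forall x, U x -> V (h x)) ->
  smooth_mx_on U h -> Ck k V f -> Ck k U (f \o h).
Proof.
move=> Uo hUV sh; elim: k f => [|k IH] f.
  move=> cf x Ux; apply: continuous_comp; last exact/cf/hUV.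
  by have [/differentiable_continuous] := smooth_mx_diff sh Ux.
move=> [df ddf]; split=> [x Ux|v].
  have [dh _] := smooth_mx_diff sh Ux.
  exact/differentiable_comp/df/hUV.
apply: (@Ck_eq _ _ _ (fun x =>
  \sum_j 'd (fun y => h y 0 j) x v * 'd f (h x) (delta_mx 0 j))) => //.
  move=> x Ux; have [dh dhE] := smooth_mx_diff sh Ux.
  rewrite (diff_comp dh (df _ (hUV x Ux))) /= diff_rVE.
  by under [RHS]eq_bigr do rewrite dhE.
apply: Ck_sum => // j; apply: CkM => //; last first.
  exact: (IH (fun y => 'd f y (delta_mx 0 j)) (ddf _)).
by have [_ /(_ v)] := sh 0 j k.+1.
Qed.

Lemma Ck_coord {n} k (U : set 'rV[R]_n) j : Ck k U (fun x => x 0 j).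
Proof.
case: k => [|k]; first by move=> x _; exact: coord_continuous.
split=> [x _|v]; first exact: differentiable_coord.
rewrite (_ : (fun x => _) = cst (v 0 j)); first exact: Ck_cst.
apply/funext => x; have [|_ <-] := @differentiable_mx_coords _ 1 n id x.
  by move=> i l; exact: differentiable_coord.
by rewrite (@diff_val _ _ _ _ _ _ id).
Qed.

End CkTheory.

(** * Flat functions *)

Section FlatFunctions.
Context {R : realType}.

(** The function equal to [exp (- 1 / t)] for [t > 0] and to [0] elsewhere, and
    its multiples by powers of [1 / t]: this family is closed under
    differentiation, so that all its members can be proved smooth together. *)
Definition flat (m : nat) (t : R) : R :=
  if 0 < t then t^-1 ^+ m * expR (- t^-1) else 0.

Lemma flat_gt0 m t : 0 < t -> 0 < flat m t.
Proof. by move=> t0; rewrite /flat t0 mulr_gt0 ?expR_gt0 ?exprn_gt0 ?invr_gt0. Qed.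

Lemma flat_le0 m t : t <= 0 -> flat m t = 0.
Proof. by rewrite /flat ltNge => ->. Qed.

(** With [u = 1 / t], one term of the exponential series gives
    [u ^ (m + 2) <= (m + 2)! exp u], that is, [flat m t <= (m + 2)! t ^ 2]. A
    quadratic bound is what differentiability at [0] needs. *)
Lemma flat_bound m t : `|flat m t| <= (m.+2)`!%:R * t ^+ 2.
Proof.
have [t0|t0] := leP t 0.
  by rewrite flat_le0 // normr0 mulr_ge0 // sqr_ge0.
rewrite gtr0_norm ?flat_gt0 // /flat t0 expRN.
set u := t^-1; have u0 : 0 < u by rewrite invr_gt0.
have -> : t = u^-1 by rewrite invrK.
clearbody u.
rewrite exprVn ler_pdivrMr ?expR_gt0 // mulrAC ler_pdivlMr ?exprn_gt0 //.
rewrite -exprD addn2 mulrC -ler_pdivrMr ?ltr0n ?fact_gt0 //.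
by apply: le_trans (expR_ge1Dxn m.+1 (ltW u0)); rewrite lerDr.
Qed.

(** For [t > 0] this is calculus, for [t < 0] the function vanishes near [t],
    and at [0] the quadratic bound makes the function negligible before the
    identity. *)
Lemma flat_is_diff m t :
  is_diff t (flat m) ( *:%R^~ (flat m.+2 t - m%:R * flat m.+1 t)).
Proof.
have [t0|t0|->] := ltgtP t 0.
- have fn : \forall s \near t, cst 0 s = flat m s.
    near=> s; rewrite flat_le0 //; apply: ltW; near: s; exact: lt_nbhsl.
  have [df dE] := near_eq_is_diff fn (differentiable_cst _ _).
  apply: DiffDef => //; rewrite dE diff_cst; apply/funext => h.
  by rewrite !flat_le0 ?ltW // mulr0 subrr scaler0.
- have tn0 : t != 0 by rewrite gt_eqF.
  pose p (s : R) := s^-1 ^+ m * expR (- s^-1).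
  have fn : \forall s \near t, p s = flat m s.
    near=> s; rewrite /flat ifT //; near: s; exact: lt_nbhsr.
  have dp : is_derive t 1 p (flat m.+2 t - m%:R * flat m.+1 t).
    have di : is_derive t 1 (fun s : R => s^-1) (- t ^- 2).
      by apply: is_derive_eq; [exact: is_deriveV|rewrite scaler1].
    have dm := is_deriveX m di.
    have de : is_derive t 1 (fun s : R => expR (- s^-1)) (expR (- t^-1) * t ^- 2).
      have dn := is_deriveN di; rewrite opprK in dn.
      exact: (is_derive1_comp (is_derive_expR _) dn).
    have := is_deriveM dm de; rewrite exprfctE => /is_derive_eq; apply.
    rewrite /flat t0 /GRing.scale /=.
    case: m {dm p fn} => [|m] /=; rewrite ?exprS ?exprVn ?mul0r.
      by field.
    by field; rewrite expf_neq0 /=.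
  have [d1 dE1] := dp; have dd := (derivable1_diffP _ _).1 d1.
  have [df dE] := near_eq_is_diff fn dd.
  apply: DiffDef => //; rewrite dE diff1E //; apply/funext => h.
  by rewrite derive1E dE1.
- have o : flat m \o shift 0 = cst (flat m 0) + (\0 : R -> R) +o_ 0 id.
    apply/eqaddoP => e e0; near=> h.
    rewrite !fctE /= addr0 (flat_le0 _ (lexx 0)) addr0 subr0.
    apply: le_trans (flat_bound m h) _.
    rewrite -[h ^+ 2]ger0_norm ?sqr_ge0 // normrX expr2 mulrA ler_wpM2r //.
    rewrite -ler_pdivlMl ?ltr0n ?fact_gt0 //.
    near: h; exists ((m.+2)`!%:R^-1 * e) => /=.
      by rewrite mulr_gt0 // invr_gt0 ltr0n fact_gt0.
    by move=> h /=; rewrite sub0r normrN => /ltW.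
  have c0 : continuous (\0 : {linear R -> R}) by move=> x; exact: cst_continuous.
  have dE : 'd (flat m) 0 = \0 :> (R -> R) by exact: (diff_unique c0 o).
  apply: DiffDef; first by apply/diff_locallyP; rewrite dE.
  rewrite dE; apply/funext => h.
  by rewrite !flat_le0 // mulr0 subrr scaler0.
Unshelve. all: by end_near. Qed.

Lemma Ck_flat {n} k (U : set 'rV[R]_n) (q : 'rV[R]_n -> R) m :
  open U -> smooth_on U q -> Ck k U (fun x => flat m (q x)).
Proof.
move=> Uo sq; elim: k m => [|k IH] m.
  move=> x Ux; apply: continuous_comp; first exact: (sq 0%N).
  have [+ _] := flat_is_diff m (q x); exact: differentiable_continuous.
have [dq _] := sq 1%N; split=> [x Ux|v].
  by apply: differentiable_comp (dq x Ux) _; have [+ _] := flat_is_diff m (q x).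
apply: (@Ck_eq _ _ _ _ (fun x =>
  'd q x v * (flat m.+2 (q x) + (- m%:R) * flat m.+1 (q x)))) => //.
  move=> x Ux; have [df dE] := flat_is_diff m (q x).
  have -> : (fun x => flat m (q x)) = flat m \o q by [].
  by rewrite (diff_comp (dq x Ux) df) /= dE mulNr.
apply: CkM => //; first by have [_] := sq k.+1; apply.
apply: CkD => //.
by apply: CkM => //; exact: Ck_cst.
Qed.

End FlatFunctions.

(** * Smooth functions with a prescribed differential *)

Section SmoothFunctions.
Context {R : realType}.

Lemma is_diff_sum {V W : normedModType R} (I : Type) (r : seq I)
    (f df : I -> V -> W) x :
  (forall i, is_diff x (f i) (df i)) ->
  is_diff x (\sum_(i <- r) f i) (\sum_(i <- r) df i).
Proof.
move=> fdf; elim: r => [|i r IH]; first by rewrite !big_nil; exact: is_diff_cst.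
by rewrite !big_cons; exact: is_diffD.
Qed.

Lemma is_diff_coord {m n} (x : 'M[R]_(m, n)) i j :
  is_diff x (fun y : 'M[R]_(m, n) => y i j : R) (fun y => y i j).
Proof.
have [|_ dE] := @differentiable_mx_coords _ _ m n id x.
  by move=> k l; exact: differentiable_coord.
apply: DiffDef; first exact: differentiable_coord.
by apply/funext => v; rewrite -dE (@diff_val _ _ _ _ _ _ id).
Qed.

Lemma open_chart_preimage {n} {T : topologicalType} (c : chart R n T) (A : set T) :
  open A -> open (cod c `&` bwd c @^-1` A).
Proof.
move=> oA; rewrite openE => y [cy Ay]; apply: filterI.
  by apply: open_nbhs_nbhs; split=> //; exact: cod_open.
by apply: (bwd_continuous cy); exact: open_nbhs_nbhs.
Qed.

Lemma rV_closed_ball_compact {n} (y : 'rV[R]_n) (e : R) :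
  compact [set z | `|y - z| <= e].
Proof.
apply: bounded_closed_compact.
  exists (`|y| + e); split=> [|M hM z /= yz]; first exact: num_real.
  rewrite ltW // (le_lt_trans _ hM) // -[z](subKr y) (le_trans (ler_normB _ _)) //.
  by rewrite lerD2l.
rewrite (_ : mkset _ = (fun z => `|y - z|) @^-1` [set t | t <= e]) //.
apply: closed_comp; last exact: closed_le.
move=> z _; apply: continuous_comp; last exact: norm_continuous.
by apply: continuousB; [exact: cst_continuous|exact: cvg_id].
Qed.

Lemma Ck_translated_coord {n} k (U : set 'rV[R]_n) j (a : R) :
  open U -> Ck k U (fun x => x 0 j + - a).
Proof. by move=> Uo; apply: CkD => //; [exact: Ck_coord|exact: Ck_cst]. Qed.

(** The squared Euclidean distance is used because it is smooth, unlike the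
    sup norm of the ambient space. *)
Definition flat_bump {n} (y0 : 'rV[R]_n) (e : R) (y : 'rV[R]_n) : R :=
  flat 0 (e ^+ 2 + - 1 * \sum_j (y 0 j + - y0 0 j) * (y 0 j + - y0 0 j)).

Lemma Ck_flat_bump {n} k (y0 : 'rV[R]_n) e : Ck k setT (flat_bump y0 e).
Proof.
apply: Ck_flat; first exact: openT.
have oT := @openT 'rV[R]_n.
move=> l; apply: CkD => //; first exact: Ck_cst.
apply: CkM => //; first exact: Ck_cst.
apply: Ck_sum => // j; apply: CkM => //; exact: Ck_translated_coord.
Qed.

Lemma flat_bump_center_gt0 {n} (y0 : 'rV[R]_n) e : 0 < e -> 0 < flat_bump y0 e y0.
Proof.
move=> e0; rewrite /flat_bump big1 => [|j _]; last by rewrite subrr mulr0.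
by rewrite mulr0 addr0 flat_gt0 // exprn_gt0.
Qed.

(** The sup norm is at most the Euclidean norm, so outside the closed ball of
    the sup norm the argument of [flat] is nonpositive. *)
Lemma flat_bump_eq0 {n} (y0 y : 'rV[R]_n) e :
  0 < e -> ~ `|y0 - y| <= e -> flat_bump y0 e y = 0.
Proof.
move=> e0 ye; apply: flat_le0; rewrite mulN1r subr_le0 leNgt; apply/negP => qe.
apply: ye; rewrite [leLHS]/Num.Def.normr /= mx_normrE.
apply: bigmax_le; first exact: ltW.
move=> [i j] _ /=; rewrite ord1 !mxE distrC.
rewrite -(ler_pXn2r (ltn0Sn 1)) ?nnegrE ?(ltW e0) // real_normK ?num_real //.
apply: le_trans (ltW qe); rewrite (bigD1 j) //= expr2 lerDl.
by apply: sumr_ge0 => l _; rewrite -expr2 sqr_ge0.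
Qed.

(** The linear form centred at [y0] times a bump function normalized at [y0]:
    the linear factor vanishes at [y0], so the bump function contributes only
    its value there to the differential. *)
Lemma exists_localized_linear_form {n} (y0 : 'rV[R]_n) (e : R)
    (a : 'cV[R]_n) :
  0 < e ->
  exists phi : 'rV[R]_n -> R,
    [/\ smooth_on setT phi, forall v, 'd phi y0 v = (v *m a) 0 0 &
        forall y, ~ `|y0 - y| <= e -> phi y = 0].
Proof.
move=> e0; pose b := flat_bump y0 e.
pose l := \sum_j (fun y : 'rV[R]_n => (y 0 j + - y0 0 j) * (a j 0 / b y0)).
have lE y : l y = \sum_j (y 0 j + - y0 0 j) * (a j 0 / b y0).
  by rewrite /l fct_sumE.
have b0 : 0 < b y0 by exact: flat_bump_center_gt0.
have oT := @openT 'rV[R]_n.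
exists (b * l); split=> [k|v|y ye].
- apply: CkM => //; first exact: Ck_flat_bump.
  rewrite (_ : l = fun y => \sum_j (y 0 j + - y0 0 j) * (a j 0 / b y0)); last first.
    exact/funext.
  apply: Ck_sum => // j; apply: CkM => //; last exact: Ck_cst.
  exact: Ck_translated_coord.
- have db : differentiable b y0 by have [+ _] := Ck_flat_bump 1 y0 e; apply.
  have dl : is_diff y0 l (\sum_j (fun y : 'rV[R]_n => y 0 j * (a j 0 / b y0))).
    apply: is_diff_sum => j.
    have dj := is_diffB (is_diff_coord y0 0 j) (is_diff_cst (y0 0 j) y0).
    have := is_diffM dj (is_diff_cst (a j 0 / b y0) y0).
    move=> /is_diff_eq; apply; apply/funext => y.
    by rewrite !fctE /= subrr /= scaler0 add0r subr0 [LHS]mulrC.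
  have [dl1 dl2] := dl; rewrite diffM //= dl2 !fctE.
  have -> : l y0 = 0 by rewrite lE big1 // => j _; rewrite subrr mul0r.
  rewrite /= scale0r addr0 fct_sumE mxE /GRing.scale /= mulr_sumr.
  apply: eq_bigr => j _; rewrite mulrCA; congr (_ * _).
  by rewrite mulrC divfK // gt_eqF.
- by rewrite fctE /= /b flat_bump_eq0 // mul0r.
Qed.

(** A localized linear form in the preferred chart of [x], extended by zero. The
    extension vanishes outside the image of a closed ball, which is compact,
    hence closed in [M]: this is where the Hausdorff property enters. Near a
    point of the chart domain smoothness comes from the chart transitions, and
    near any other point the function is zero. *)
Lemma exists_smooth_dfun {n} (M : manifold R n) (x : M) (a : 'cV[R]_n) :
  exists2 F : M -> R, smooth_fun F & dfun F x = a.
Proof.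
pose c := chart_at x; pose y0 := fwd c x.
have cy0 : cod c y0 by apply: fwd_cod; exact: chart_at_dom.
have ncy0 : nbhs y0 (cod c) by apply: open_nbhs_nbhs; split=> //; exact: cod_open.
have [e e0 ec] : exists2 e, 0 < e & [set y | `|y0 - y| <= e] `<=` cod c.
  have /nbhs_ballP[e /= e0 ec] := ncy0.
  exists (e / 2); first by rewrite divr_gt0.
  move=> y /= ye; apply: ec; rewrite -ball_normE /=.
  by rewrite (le_lt_trans ye) // ltr_pdivrMr // ltr_pMr // ltr1n.
have [phi [sphi dphi phi0]] := exists_localized_linear_form y0 a e0.
pose K := bwd c @` [set y | `|y0 - y| <= e].
have Kcl : closed K.
  apply: compact_closed; first exact: manifold_hausdorff.
  apply: continuous_compact; last exact: rV_closed_ball_compact.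
  apply: continuous_in_subspaceT => y; rewrite inE => /ec.
  exact: bwd_continuous.
pose F (z : M) : R := if pselect (dom c z) then phi (fwd c z) else 0.
exists F.
  move=> d Md k; apply: Ck_local => y dy.
  (* The two cases cover [M] by the chart domain and the complement of [K]. *)
  have [cz|cz] := pselect (dom c (bwd d y)).
    have oV := open_chart_preimage (c := d) (dom_open c).
    exists (cod d `&` bwd d @^-1` dom c) => //.
    apply: (Ck_eq oV _ (@Ck_comp _ _ _ _ _ setT _ phi oV _ _ (sphi k))).
    - by move=> z [dz cz'] /=; rewrite /F; case: pselect.
    - by [].
    - by apply: atlas_compatible => //; exact: chart_at_atlas.
  have oV : open (cod d `&` bwd d @^-1` (~` K)).
    by apply: open_chart_preimage; exact: closed_openC.
  exists (cod d `&` bwd d @^-1` (~` K)).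
    by split=> // -[w we wz]; apply: cz; rewrite -wz; exact/bwd_dom/ec.
  apply: (Ck_eq oV _ (Ck_cst _ _ 0)) => z [dz Kz] /=.
  rewrite /F; case: pselect => // cz'; rewrite phi0 // => we; apply: Kz.
  by exists (fwd c (bwd d z)) => //; exact: fwdK.
apply/colP => j; rewrite mxE -/c -/y0.
have FE : \forall y \near y0, phi y = (F \o bwd c) y.
  apply: filterS ncy0 => y cy /=.
  rewrite /F; case: pselect => [cz|]; first by rewrite bwdK.
  by case; exact: bwd_dom.
have dphi1 : differentiable phi y0 by have [+ _] := sphi 1%N; apply.
have [_ ->] := near_eq_is_diff FE dphi1.
by rewrite dphi -rowE mxE.
Qed.

End SmoothFunctions.

(** * Linear algebra of a leaf at a point *)

Section LinearAlgebra.
Context {F : fieldType}.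

Lemma bilinear_form_inj {m n} (A B : 'M[F]_(m, n)) :
  (forall (u : 'rV_m) (v : 'rV_n), (u *m A *m v^T) 0 0 = (u *m B *m v^T) 0 0) ->
  A = B.
Proof.
move=> AB; apply/matrixP => i j; have := AB (delta_mx 0 i) (delta_mx 0 j).
by rewrite trmx_delta -!rowE -!colE !mxE.
Qed.

Lemma bilinear_form_unitmx {k} (A : 'M[F]_k) :
  (forall u : 'rV_k, (forall v : 'rV_k, (u *m A *m v^T) 0 0 = 0) -> u = 0) <->
  A \in unitmx.
Proof.
split=> [ndA|uA u uA0].
  rewrite -row_free_unit; apply: inj_row_free => u uA0; apply: ndA => v.
  by rewrite uA0 mul0mx mxE.
rewrite -(mulmxK uA u); suff -> : u *m A = 0 by rewrite mul0mx.
apply: (@bilinear_form_inj 1 k) => x v.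
by rewrite [x]mx11_scalar !mul_scalar_mx -!scalemxAl mxE uA0 mul0mx mulr0 !mxE mulr0.
Qed.

(** Taking [A = B] gives symmetric matrices, taking [B = - A] skew ones. *)
Lemma bilinear_form_trmx {n} (A B : 'M[F]_n) :
  (forall u v : 'rV_n, (u *m A *m v^T) 0 0 = (v *m B *m u^T) 0 0) -> A^T = B.
Proof.
move=> AB; apply: bilinear_form_inj => u v.
have -> : u *m A^T *m v^T = (v *m A *m u^T)^T by rewrite !trmx_mul trmxK mulmxA.
by rewrite mxE AB.
Qed.

(** For a skew [P] the image of [a |-> (P a)^T] is the row space of [P], so the
    hypothesis says that [J] and [P] have the same row space. *)
Lemma skew_image_factorization {n k} (J : 'M[F]_(k, n)) (P : 'M[F]_n) :
  P^T = - P ->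
  (forall v : 'rV_n, (exists u, v = u *m J) <-> (exists a, v = (P *m a)^T)) ->
  (exists A, J = A *m P) /\ (exists B, P = B *m J).
Proof.
move=> skP imP; split; apply/submxP/row_subP => i.
  have /imP[a ->] : exists u, row i J = u *m J.
    by exists (delta_mx 0 i); rewrite rowE.
  by rewrite trmx_mul skP mulmxN -mulNmx submxMl.
have /imP[u ->] : exists a, row i P = (P *m a)^T.
  exists (- (delta_mx 0 i)^T).
  by rewrite trmx_mul linearN /= trmxK skP mulmxN mulNmx opprK rowE.
exact: submxMl.
Qed.

(** Here [J] is the inclusion of the tangent space of a leaf and [- B^T] sends a
    covector to its Hamiltonian vector, read in the leaf. Writing [J = A P] and
    [P = B J], freeness of [J] gives [A B = 1]. The hypothesis on [w] says that
    [P = B w B^T], which [A] turns into [J = w B^T]. *)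
Lemma leaf_form_factorization {n k} (J : 'M[F]_(k, n)) (P : 'M[F]_n)
    (w : 'M[F]_k) :
  P^T = - P -> row_free J ->
  (forall v : 'rV_n, (exists u, v = u *m J) <-> (exists a, v = (P *m a)^T)) ->
  (forall a b (u v : 'rV_k), u *m J = (P *m a)^T -> v *m J = (P *m b)^T ->
     (u *m w *m v^T) 0 0 = (a^T *m P *m b) 0 0) ->
  exists2 B : 'M[F]_(n, k), P = B *m J & J = w *m B^T.
Proof.
move=> skP /row_freeP[K JK] imP wP.
have [[A JE] [B PE]] := skew_image_factorization skP imP.
exists B => //.
have AB : A *m B = 1%:M.
  by rewrite -[LHS]mulmx1 -JK mulmxA -[A *m B *m J]mulmxA -PE -JE.
suff PBw : P = B *m w *m B^T by rewrite {1}JE PBw !mulmxA AB mul1mx.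
apply: bilinear_form_inj => x y.
have HJ (z : 'rV_n) : - (z *m B) *m J = (P *m z^T)^T.
  by rewrite trmx_mul trmxK skP mulmxN mulNmx -mulmxA -PE.
have := wP _ _ _ _ (HJ x) (HJ y); rewrite trmxK => <-.
by rewrite linearN /= mulmxN !mulNmx opprK trmx_mul !mulmxA.
Qed.

(** The gradient equation [W tau = (J a)^T] at a point, with
    [tau = w h^-1 w^T] and [h = J g J^T]. Since [J = w B^T], its right-hand side
    is [a^T B w^T], and cancelling the invertible [w^T] and [h^-1] leaves
    [W w = a^T B J g J^T = a^T P g J^T]. Multiplying by [B^T] and using
    [J = w B^T], [(B J)^T = P^T = - P] gives the result. *)
Lemma double_bracket_gradient {n k} (J : 'M[F]_(k, n)) (P g : 'M[F]_n)
    (w : 'M[F]_k) (B : 'M[F]_(n, k)) (a : 'cV[F]_n) (W : 'rV[F]_k) :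
  P^T = - P -> P = B *m J -> J = w *m B^T -> w \in unitmx ->
  J *m g *m J^T \in unitmx ->
  W *m (w *m invmx (J *m g *m J^T) *m w^T) = (J *m a)^T ->
  W *m J = - (a^T *m P *m g *m P).
Proof.
move=> skP PE JE uw; set h := J *m g *m J^T => uh.
have uwT : w^T \in unitmx by rewrite unitmx_tr.
have -> : (J *m a)^T = a^T *m B *m w^T.
  by rewrite trmx_mul {1}JE trmx_mul trmxK mulmxA.
rewrite !mulmxA => /(can_inj (mulmxK uwT)) /(congr1 (mulmx^~ h)).
rewrite mulmxKV // /h => WwE.
rewrite [J in LHS]JE mulmxA WwE !mulmxA -[a^T *m B *m J]mulmxA -PE.
by rewrite -[_ *m J^T *m B^T]mulmxA -trmx_mul -PE skP mulmxN.
Qed.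

End LinearAlgebra.

(** * Symplectic leaves *)

Section Leaves.
Context {R : realType}.

Lemma dfunE {n} (M : manifold R n) (f : M -> R) x v :
  'd (f \o bwd (chart_at x)) (fwd (chart_at x) x) v = (v *m dfun f x) 0 0.
Proof. by rewrite diff_rVE mxE; apply: eq_bigr => j _; rewrite mxE. Qed.

Lemma dfun_comp {n k} (M : manifold R n) (S : manifold R k) (i : S -> M)
    (f : M -> R) s :
  smooth_map i -> smooth_fun f ->
  dfun (fun s => f (i s)) s = dmap i s *m dfun f (i s).
Proof.
move=> [ci si] sf; rewrite /dmap.
set h := fwd (chart_at (i s)) \o i \o _; set y := fwd (chart_at s) s.
have sy : bwd (chart_at s) y = s by apply: fwdK; exact: chart_at_dom.
pose V := i @^-1` dom (chart_at (i s)).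
have oU : open (cod (chart_at s) `&` bwd (chart_at s) @^-1` V).
  by apply: open_chart_preimage; apply: open_comp (dom_open _) => z _; exact: ci.
have Uy : (cod (chart_at s) `&` bwd (chart_at s) @^-1` V) y.
  split; first by apply: fwd_cod; exact: chart_at_dom.
  by rewrite /V /= sy; exact: chart_at_dom.
have [dh _] := smooth_mx_diff
  (si _ _ (chart_at_atlas s) (chart_at_atlas (i s))) Uy.
have hy : h y = fwd (chart_at (i s)) (i s) by rewrite /h /= sy.
have df : differentiable (f \o bwd (chart_at (i s))) (h y).
  have [+ _] := sf _ (chart_at_atlas (i s)) 1%N; apply.
  by rewrite hy; apply: fwd_cod; exact: chart_at_dom.
have fE : \forall z \near y, ((f \o bwd (chart_at (i s))) \o h) z =
    ((fun s => f (i s)) \o bwd (chart_at s)) z.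
  apply: filterS (open_nbhs_nbhs (conj oU Uy)) => z [_ Vz] /=.
  by rewrite /h /= fwdK.
have [_ dE] := near_eq_is_diff fE (differentiable_comp dh df).
apply/colP => j; rewrite mxE dE (diff_comp dh df) /= sy dfunE.
have -> : 'd h y (delta_mx 0 j) = delta_mx 0 j *m 'J h y.
  by rewrite /jacobian mul_rV_lin1.
by rewrite -mulmxA -rowE mxE.
Qed.

Lemma poisson_tensor_skew {n} (M : manifold R n) br (P : M -> 'M[R]_n) x :
  poisson_tensor br P -> (P x)^T = - P x.
Proof.
case=> _ skP _; apply: bilinear_form_trmx => u v.
have := skP x u^T v^T; rewrite /Defs.contra !trmxK => ->.
by rewrite mulmxN mulNmx [RHS]mxE.
Qed.

(** The sign of the definition cancels against that of [P^T = - P]. *)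
Lemma double_bracket_vf_mulmx {n} (M : manifold R n) (g P : M -> 'M[R]_n) G x :
  (P x)^T = - P x ->
  double_bracket_vf g P G x = (dfun G x)^T *m P x *m g x *m P x.
Proof.
move=> skP; apply/rowP => j.
rewrite [LHS]mxE [X in - X]mxE /double_bracket_tensor /cov /sharp trmxK trmx_mul.
by rewrite skP mulmxN !mulNmx [X in - X]mxE opprK mulmxA -colE mxE.
Qed.

(** The symplectic form is only specified on Hamiltonian vector fields of global
    functions; every covector being the differential of one, this determines it
    on the whole tangent space of the leaf. *)
Lemma leaf_form_contra {n k} (M : manifold R n) br (P : M -> 'M[R]_n)
    (S : manifold R k) (i : S -> M) (w : S -> 'M[R]_k) s :
  poisson_tensor br P -> leaf_symplectic_form br P i w ->
  forall a b u v, u *m dmap i s = sharp P (i s) a ->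
    v *m dmap i s = sharp P (i s) b ->
    (u *m w s *m v^T) 0 0 = Defs.contra P (i s) a b.
Proof.
move=> [_ _ Pbr] wbr a b u v.
have [F sF <-] := exists_smooth_dfun (i s) a.
have [H sH <-] := exists_smooth_dfun (i s) b.
by rewrite Pbr //; exact: wbr.
Qed.

Lemma double_bracket_metricE {k} (S : manifold R k) (h w : S -> 'M[R]_k) s u v :
  double_bracket_metric h w s u v =
  (u *m (w s *m invmx (h s) *m (w s)^T) *m v^T) 0 0.
Proof.
rewrite /double_bracket_metric /cometric /Defs.contra /Defs.interior.
by rewrite trmxK trmx_mul !mulmxA.
Qed.

Lemma is_gradientP {k} (S : manifold R k) (T : S -> 'M[R]_k)
    (tau : S -> 'rV[R]_k -> 'rV[R]_k -> R) f W :
  (forall s u v, tau s u v = (u *m T s *m v^T) 0 0) ->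
  is_gradient tau f W <-> forall s, W s *m T s = (dfun f s)^T.
Proof.
move=> tauE.
have dE s (v : 'rV_k) : (v *m dfun f s) 0 0 = ((dfun f s)^T *m v^T) 0 0.
  by rewrite -trmx_mul [RHS]mxE.
split=> [gW s|gW s v]; last by rewrite tauE gW dE.
apply: (@bilinear_form_inj R 1 k) => x v.
rewrite [x]mx11_scalar !mul_scalar_mx -!scalemxAl [LHS]mxE [RHS]mxE.
by rewrite -tauE gW dE.
Qed.

Lemma exists_unique_gradient {k} (S : manifold R k) (T : S -> 'M[R]_k)
    (tau : S -> 'rV[R]_k -> 'rV[R]_k -> R) f :
  (forall s u v, tau s u v = (u *m T s *m v^T) 0 0) ->
  (forall s, T s \in unitmx) ->
  exists! W : S -> 'rV[R]_k, is_gradient tau f W.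
Proof.
move=> tauE uT; exists (fun s => (dfun f s)^T *m invmx (T s)); split.
  by apply/(is_gradientP _ _ tauE) => s; rewrite mulmxKV.
by move=> W /(is_gradientP _ _ tauE) gW; apply/funext => s; rewrite -gW mulmxK.
Qed.

End Leaves.

Theorem theorem2p2 (R : realType) (n : nat) (M : manifold R n)
    (g : M -> 'M[R]_n) (br : (M -> R) -> (M -> R) -> (M -> R))
    (P : M -> 'M[R]_n) (G : M -> R)
    (g_metric : pseudo_riemannian g)
    (br_poisson : poisson_bracket br)
    (P_tensor : poisson_tensor br P)
    (G_smooth : smooth_fun G) :
  (forall (k : nat) (S : manifold R k) (i : S -> M),
     regular_leaf P i -> tangent_along i (double_bracket_vf g P G)) /\
  (riemannian g ->
   forall (k : nat) (S : manifold R k) (i : S -> M), regular_leaf P i ->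
     forall s, nondegenerate_form (cov (induced_metric g i) s)) /\
  (forall (k : nat) (S : manifold R k) (i : S -> M) (w : S -> 'M[R]_k),
     regular_leaf P i ->
     two_form w -> leaf_symplectic_form br P i w ->
     (forall s, nondegenerate_form (cov (induced_metric g i) s)) ->
     let tau := double_bracket_metric (induced_metric g i) w in
     (forall s, (forall u v, tau s u v = tau s v u) /\ nondegenerate_form (tau s)) /\
     (exists! W : S -> 'rV[R]_k, is_gradient tau (fun s => G (i s)) W) /\
     (forall W : S -> 'rV[R]_k, is_gradient tau (fun s => G (i s)) W ->
        restricts_to i (double_bracket_vf g P G) (fun s => - W s))).
Proof.
have skP x : (P x)^T = - P x := poisson_tensor_skew x P_tensor.
split; [|split].
- move=> k S i [[[_ _ _ imP] _] _] s.
  have [_ [B PE]] := skew_image_factorization (skP (i s)) (imP s).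
  rewrite double_bracket_vf_mulmx // [X in _ *m X]PE mulmxA.
  by eexists.
- move=> [_ g_pos] k S i [[[_ _ free _] _] _] s u u0.
  apply/eqP; apply: contraT => un0.
  have Ju : u *m dmap i s != 0.
    apply: contra un0 => /eqP uJ0; apply/eqP.
    by apply: (row_free_inj (free s)); rewrite uJ0 mul0mx.
  have := g_pos (i s) _ Ju.
  have := u0 u; rewrite /cov /induced_metric trmx_mul !mulmxA => ->.
  by rewrite ltxx.
move=> k S i w [[[_ [smi _] free imP] _] _] _ w_br nd_h tau.
have fact s := leaf_form_factorization (skP (i s)) (free s) (imP s)
  (leaf_form_contra P_tensor w_br).
set h := induced_metric g i in nd_h tau *.
have uh s : h s \in unitmx by apply/bilinear_form_unitmx; exact: nd_h.
have uw s : w s \in unitmx.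
  have [B _ JE] := fact s; have /row_freeP[K JK] := free s.
  by apply: (mulmx1_unit (B := B^T *m K) _).1; rewrite mulmxA -JE.
pose T s := w s *m invmx (h s) *m (w s)^T.
have tauE s u v : tau s u v = (u *m T s *m v^T) 0 0.
  exact: double_bracket_metricE.
have uT s : T s \in unitmx by rewrite !unitmx_mul unitmx_inv unitmx_tr uw uh.
have symT s : (T s)^T = T s.
  have g_sym : (g (i s))^T = g (i s).
    by case: g_metric => _ sym _; apply: bilinear_form_trmx; exact: sym.
  rewrite /T !trmx_mul trmxK trmx_inv mulmxA; congr (_ *m invmx _ *m _).
  by rewrite /h /induced_metric !trmx_mul trmxK g_sym mulmxA.
split; [move=> s; split; [move=> u v|]|split].
- rewrite !tauE -[in RHS]symT.
  have -> : v *m (T s)^T *m u^T = (u *m T s *m v^T)^T.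
    by rewrite (trmx_mul (u *m T s)) trmxK (trmx_mul u) mulmxA.
  by rewrite [RHS]mxE.
- move=> u tau0; apply: (bilinear_form_unitmx (T s)).2 => // v.
  by rewrite -tauE.
- exact: exists_unique_gradient tauE uT.
move=> W /(is_gradientP _ _ tauE) gW s.
have [B PE JE] := fact s.
have WE : W s *m dmap i s = - ((dfun G (i s))^T *m P (i s) *m g (i s) *m P (i s)).
  apply: (double_bracket_gradient (skP (i s)) PE JE (uw s) (uh s)).
  by rewrite -dfun_comp //; exact: gW.
by rewrite mulNmx WE opprK; exact: double_bracket_vf_mulmx.
Qed.
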